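(* For every $c\in(-1,+\infty)$ the function $L_c\colon\mathbb{R}^+\times\mathbb{R}^+\to\mathbb{R}^+$ defined by $$L_c(a,b)=\frac{a+b}{2}\cdot\frac{1+2c}{2(1+c)}+\frac{1}{2(1+c)}\sqrt{\left(\frac{a+b}{2}\right)^2+4c(1+c)\left(\frac{b-a}{2}\right)^2}$$ is a mean.
   Context: $\mathbb{R}^+$ denotes the set of positive real numbers. A function $M\colon\mathbb{R}^+\times\mathbb{R}^+\to\mathbb{R}$ is called a mean if $\min(s,t)\le M(s,t)\le\max(s,t)$ for all $s,t\in\mathbb{R}^+$. *)

(* Defs.v *)
(* Stdlib reals; the set of positive reals is Stdlib's [posreal]. *)
From Stdlib Require Import Reals.
Open Scope R_scope.

Definition is_mean (M : posreal -> posreal -> R) : Prop :=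
  forall s t : posreal, Rmin s t <= M s t <= Rmax s t.

Definition L_radicand (c : R) (a b : posreal) : R :=
  ((a + b) / 2) ^ 2 + 4 * c * (1 + c) * ((b - a) / 2) ^ 2.

(* [sqrt] is total (0 on negative arguments) and the codomain here is [R], so
   nonnegativity of [L_radicand] and positivity of [L] have to be asserted
   separately to express that [L c] is a well-defined positive function. *)
Definition L (c : R) (a b : posreal) : R :=
  (a + b) / 2 * ((1 + 2 * c) / (2 * (1 + c)))
  + 1 / (2 * (1 + c)) * sqrt (L_radicand c a b).

(* Main.v *)
(* With [A = (a + b) / 2], [m = |b - a| / 2 < A] and [p = 2 (1 + c) > 0], the
   radicand is [A^2 + p (p - 2) m^2] and [L c a b = A + (S - A) / p] for [S]
   its square root. Since [min a b = A - m] and [max a b = A + m], being a mean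
   amounts to [A - p m <= S <= A + p m], and this follows from
   [(A - p m)^2 - S^2 = - 2 p m (A - m)] and [(A + p m)^2 - S^2 = 2 p m (A + m)]. *)
Require Import Defs.
From Stdlib Require Import Reals Lra Psatz.
Open Scope R_scope.

Lemma sqrt_perturbation_bounds (A m p : R) :
  0 <= m -> m <= A -> 0 < p ->
  A - p * m <= sqrt (A ^ 2 + p * (p - 2) * m ^ 2) <= A + p * m.
Proof.
intros hm hmA hp.
assert (hpm : 0 <= p * m) by nra.
split.
(* Comparing squares requires [0 <= A - p * m]; a negative lower bound is below any square root. *)
- destruct (Rle_dec 0 (A - p * m)) as [h | h].
  + rewrite <- (sqrt_pow2 (A - p * m)) by exact h.
    apply sqrt_le_1_alt; nra.
  + apply Rle_trans with 0; [lra | apply sqrt_pos].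
- rewrite <- (sqrt_pow2 (A + p * m)) by lra.
  apply sqrt_le_1_alt; nra.
Qed.

(** Since [4c(1+c) = (1+2c)^2 - 1] and [((a+b)/2)^2 - ((b-a)/2)^2 = ab], the radicand is [ab] plus a
    square. *)
Lemma L_radicand_ge0 (c : R) (a b : posreal) : 0 <= L_radicand c a b.
Proof.
unfold L_radicand; destruct a as [a ha], b as [b hb]; simpl pos.
replace (((a + b) / 2) ^ 2 + 4 * c * (1 + c) * ((b - a) / 2) ^ 2)
  with (a * b + ((1 + 2 * c) * ((b - a) / 2)) ^ 2) by field.
apply Rplus_le_le_0_compat; [nra | apply pow2_ge_0].
Qed.

Lemma L_is_mean (c : R) : -1 < c -> is_mean (L c).
Proof.
intros hc [a ha] [b hb]; unfold L, L_radicand; simpl pos.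
set (A := (a + b) / 2); set (m := Rabs (b - a) / 2); set (p := 2 * (1 + c)).
assert (hp : 0 < p) by (unfold p; lra).
assert (hmin : Rmin a b = A - m).
{ unfold Rmin, A, m, Rabs; destruct Rle_dec, Rcase_abs; lra. }
assert (hmax : Rmax a b = A + m).
{ unfold Rmax, A, m, Rabs; destruct Rle_dec, Rcase_abs; lra. }
assert (hm : 0 <= m) by (generalize (Rabs_pos (b - a)); unfold m; lra).
(* By [hmin], [A - m] is the minimum of two positive numbers. *)
assert (hmA : m <= A) by (generalize (Rmin_pos a b ha hb); lra).
replace (A ^ 2 + 4 * c * (1 + c) * ((b - a) / 2) ^ 2)
  with (A ^ 2 + p * (p - 2) * m ^ 2).
2: { unfold m, p, Rdiv; rewrite !Rpow_mult_distr, pow2_abs; ring. }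
destruct (sqrt_perturbation_bounds A m p hm hmA hp) as [hlo hhi].
set (S := sqrt _) in *.
replace (A * ((1 + 2 * c) / p) + 1 / p * S) with (A + (S - A) / p)
  by (unfold p; field; lra).
(* Multiplying by [p > 0] reduces [-m <= (S - A) / p <= m] to [hlo] and [hhi]. *)
assert (hq : (S - A) / p * p = S - A) by (field; lra).
rewrite hmin, hmax; split; nra.
Qed.

Theorem theorem4 (c : R) (hc : -1 < c) :
  (forall a b : posreal, 0 <= L_radicand c a b) /\
  (forall a b : posreal, 0 < L c a b) /\
  is_mean (L c).
Proof.
split; [| split].
- exact (L_radicand_ge0 c).
- intros a b.
  apply Rlt_le_trans with (Rmin a b).
  + apply Rmin_pos; apply cond_pos.
  + apply L_is_mean, hc.
- exact (L_is_mean c hc).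
Qed.
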